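(* Let $k$ be a positive integer with $k\equiv\pm3\pmod 9$, let $\epsilon\in\{\pm1\}$ be such that $k\equiv 3\epsilon\pmod 9$, let $\alpha=\sqrt[3]{2}-1$, and let $B>0$ be a real number. For integers $d>0$ with $\gcd(d,3)=1$ and $z\in\mathbb{Z}$, let $S(d,z)$ denote the conjunction of the following four conditions: $$\frac{d}{\sqrt[3]{2}-1}<|z|\le B,\qquad \operatorname{sgn}(z)=\epsilon\left(\frac{d}{3}\right),\qquad z^3\equiv k\pmod d,$$ $$3d\left(4\epsilon\left(\frac{d}{3}\right)(z^3-k)-d^3\right)\ \text{is the square of an integer}.$$ (a) Suppose $(x,y,z)\in\mathbb{Z}^3$ satisfies $x^3+y^3+z^3=k$, $|x|\ge|y|\ge|z|>\sqrt{k}$, $y\ne z$ and $|z|\le B$. Set $d=|x+y|$. Then $0<d<\alpha B$, $\gcd(d,3)=1$, the condition $S(d,z)$ holds, and $$\{x,y\}=\left\{\frac12\operatorname{sgn}(k-z^3)\left(d\pm\sqrt{\frac{4|k-z^3|-d^3}{3d}}\right)\right\}.$$ (b) Conversely, if $d\in\mathbb{Z}\cap(0,\alpha B)$ is coprime to $3$ and $z\in\mathbb{Z}$ is such that $S(d,z)$ holds, then the two numbers $$\frac12\operatorname{sgn}(k-z^3)\left(d\pm\sqrt{\frac{4|k-z^3|-d^3}{3d}}\right)$$ are integers, and calling them $x$ and $y$ one has $x^3+y^3+z^3=k$.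
   Context: Here $\left(\frac{d}{3}\right)$ is the Legendre symbol modulo $3$ (equal to $1$ if $d\equiv1\pmod3$ and $-1$ if $d\equiv2\pmod 3$), and $\operatorname{sgn}$ denotes the sign of a real number. *)

(* Defs.v *)
From Stdlib Require Import Reals ZArith Znumtheory Ensembles.

Definition alpha : R := (Rpower 2 (1 / 3) - 1)%R.

Definition legendre3 (d : Z) : Z :=
  match (d mod 3)%Z with
  | 1%Z => 1%Z
  | 2%Z => (-1)%Z
  | _ => 0%Z
  end.

Definition is_square (n : Z) : Prop := exists m : Z, n = (m ^ 2)%Z.

(* The condition S(d, z), for fixed k, epsilon and B; it is only used for
   d > 0 with gcd(d, 3) = 1, and these two constraints are not part of it. *)
Definition S_cond (k eps : Z) (B : R) (d z : Z) : Prop :=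
  (IZR d / (Rpower 2 (1 / 3) - 1) < IZR (Z.abs z) <= B)%R /\
  Z.sgn z = (eps * legendre3 d)%Z /\
  ((z ^ 3) mod d = k mod d)%Z /\
  is_square (3 * d * (4 * eps * legendre3 d * (z ^ 3 - k) - d ^ 3))%Z.

(* The two numbers (1/2) sgn(k - z^3) (d +- sqrt ((4|k - z^3| - d^3) / (3d))).
   The square root is the total function [sqrt], which is 0 on negative
   reals; under S(d, z) with d > 0 its argument is nonnegative. *)
Definition root_term (k d z : Z) : R :=
  sqrt (IZR (4 * Z.abs (k - z ^ 3) - d ^ 3) / IZR (3 * d)).

Definition root_plus (k d z : Z) : R :=
  (1 / 2 * IZR (Z.sgn (k - z ^ 3)) * (IZR d + root_term k d z))%R.

Definition root_minus (k d z : Z) : R :=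
  (1 / 2 * IZR (Z.sgn (k - z ^ 3)) * (IZR d - root_term k d z))%R.

(* Main.v *)
Require Import Defs.
From Stdlib Require Import Reals ZArith Znumtheory Ensembles.
From Stdlib Require Import Lia Lra.

(** Write [s] for the sign of [x + y], so that [d = s * (x + y)], and use
    [x^3 + y^3 = (x + y) * (x^2 - x*y + y^2)] and
    [4 * (x^2 - x*y + y^2) = (x + y)^2 + 3 * (x - y)^2].

    Since cubes are [0], [1] or [-1] modulo [9], the congruence [k = 3 * eps]
    modulo [9] forces [x], [y] and [z] to be congruent to [eps] modulo [3]
    ([sum_cubes_mod9]).  Hence [d] is prime to [3] and [s] is the opposite of
    [eps * legendre3 d] ([legendre3_abs_sum]).  As [k < z^2], the number
    [k - z^3 = x^3 + y^3] can only have its sign opposite to that of [z], and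
    [y] must have the sign of [z] ([signs_of_solution]).  With [X = |x|],
    [Y = |y|] and [Z = |z|] this reads [X^3 = Y^3 + Z^3 + s * k]; expanding
    [(Y + alpha * Z)^3] and using [(1 + alpha)^3 = 2], one finds that
    [d = X - Y < alpha * Z] because [Y > Z] and [k < Z^2] ([cube_gap]).  The number
    under test is the square of [3 * d * (x - y)], and the square root in the
    formula is [|x - y|].

    Conversely, put [s = - eps * legendre3 d].  The congruence for [z^3] gives
    [s * (k - z^3) = d * q] for some integer [q], and the square condition then
    gives [4 * q = d^2 + 3 * r^2] ([norm_form_of_square]).  Thus [d] and [r] have
    the same parity, and [s * (d + r) / 2] and [s * (d - r) / 2] are integers
    whose cubes add up to [k - z^3]. *)

(** * Arithmetic modulo 9 and modulo 3 *)

Lemma cube_mod9 (a : Z) :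
  (a mod 3 = 0 /\ a ^ 3 mod 9 = 0 \/
   a mod 3 = 1 /\ a ^ 3 mod 9 = 1 \/
   a mod 3 = 2 /\ a ^ 3 mod 9 = 8)%Z.
Proof.
  assert (Ha := Z_div_mod_eq_full a 3).
  assert (Hr := Z.mod_pos_bound a 3 ltac:(lia)).
  set (q := (a / 3)%Z) in *.
  assert (Hc : (a mod 3 = 0 \/ a mod 3 = 1 \/ a mod 3 = 2)%Z) by lia.
  destruct Hc as [Hc | [Hc | Hc]]; rewrite Hc in Ha.
  - left; split; [exact Hc |].
    symmetry; apply Z.mod_unique with (3 * q ^ 3)%Z; [lia | rewrite Ha; ring].
  - right; left; split; [exact Hc |].
    symmetry; apply Z.mod_unique with (3 * q ^ 3 + 3 * q ^ 2 + q)%Z;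
      [lia | rewrite Ha; ring].
  - right; right; split; [exact Hc |].
    symmetry; apply Z.mod_unique with (3 * q ^ 3 + 6 * q ^ 2 + 4 * q)%Z;
      [lia | rewrite Ha; ring].
Qed.

Lemma sum_cubes_mod9 (x y z eps : Z) :
  (eps = 1 \/ eps = -1)%Z ->
  ((x ^ 3 + y ^ 3 + z ^ 3) mod 9 = (3 * eps) mod 9)%Z ->
  (x mod 3 = eps mod 3 /\ y mod 3 = eps mod 3 /\ z mod 3 = eps mod 3)%Z.
Proof.
  intros He H.
  generalize (cube_mod9 x) (cube_mod9 y) (cube_mod9 z); revert H.
  generalize (x ^ 3)%Z (y ^ 3)%Z (z ^ 3)%Z; intros a b c H Hx Hy Hz.
  rewrite Z.add_mod, (Z.add_mod a b) in H by lia.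
  destruct He as [-> | ->];
  destruct Hx as [[Hx Ha] | [[Hx Ha] | [Hx Ha]]];
  destruct Hy as [[Hy Hb] | [[Hy Hb] | [Hy Hb]]];
  destruct Hz as [[Hz Hc] | [[Hz Hc] | [Hz Hc]]];
  rewrite Ha, Hb, Hc in H; rewrite Hx, Hy, Hz;
  first [discriminate H | repeat split; reflexivity].
Qed.

Lemma legendre3_abs_sum (x y s eps : Z) :
  (eps = 1 \/ eps = -1)%Z -> (s = 1 \/ s = -1)%Z ->
  (x mod 3 = eps mod 3)%Z -> (y mod 3 = eps mod 3)%Z ->
  (eps * legendre3 (s * (x + y)) = - s)%Z.
Proof.
  intros He Hs Hx Hy.
  unfold legendre3.
  rewrite Z.mul_mod, (Z.add_mod x y), Hx, Hy by lia.
  destruct He as [-> | ->]; destruct Hs as [-> | ->]; reflexivity.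
Qed.

Lemma gcd3_legendre3 (d : Z) :
  Z.gcd d 3 = 1%Z <-> (legendre3 d = 1 \/ legendre3 d = -1)%Z.
Proof.
  rewrite Z.gcd_comm, <- Z.gcd_mod by lia.
  unfold legendre3.
  assert (Hr := Z.mod_pos_bound d 3 ltac:(lia)).
  assert (Hc : (d mod 3 = 0 \/ d mod 3 = 1 \/ d mod 3 = 2)%Z) by lia.
  destruct Hc as [-> | [-> | ->]]; cbn; lia.
Qed.

(** * The signs of a solution *)

Lemma sum_cubes_factor (x y : Z) :
  (x ^ 3 + y ^ 3 = (x + y) * (x ^ 2 - x * y + y ^ 2))%Z.
Proof. ring. Qed.

Lemma norm_form_pos (x y : Z) :
  (x + y <> 0)%Z -> (0 < x ^ 2 - x * y + y ^ 2)%Z.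
Proof.
  intros H.
  assert (0 < (x + y) ^ 2)%Z by nia.
  assert (0 <= (x - y) ^ 2)%Z by nia.
  lia.
Qed.

(** A sum of two cubes has the sign of the sum, and the inequality
    [k < z^2 <= |z|^3] excludes that [z] or [y] has this sign. *)
Lemma signs_of_solution (x y z k s : Z) :
  (0 < k)%Z -> (k < z ^ 2)%Z -> (s = 1 \/ s = -1)%Z ->
  (x ^ 3 + y ^ 3 + z ^ 3 = k)%Z ->
  (Z.abs x >= Z.abs y)%Z -> (Z.abs y >= Z.abs z)%Z ->
  (0 < s * (x + y))%Z ->
  (s * z < 0 /\ s * y < 0 /\ 0 < s * x)%Z.
Proof.
  intros Hk Hkz Hs Hsum Hxy Hyz Hd.
  assert (Hz : (z <> 0)%Z) by (intros ->; lia).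
  assert (Hq : (0 < x ^ 2 - x * y + y ^ 2)%Z)
    by (apply norm_form_pos; destruct Hs as [-> | ->]; lia).
  assert (Hf := sum_cubes_factor x y).
  assert (Hsz : (s * z < 0)%Z).
  { destruct Hs as [-> | ->].
    - assert (0 < x ^ 3 + y ^ 3)%Z by (rewrite Hf; nia).
      destruct (Z.lt_ge_cases z 0); [lia |].
      assert (z ^ 2 <= z ^ 3)%Z by nia. lia.
    - assert (x ^ 3 + y ^ 3 < 0)%Z by (rewrite Hf; nia).
      destruct (Z.lt_ge_cases 0 z); [lia |].
      assert (z ^ 3 < 0)%Z by nia. lia. }
  assert (Hsx : (0 < s * x)%Z) by (destruct Hs as [-> | ->]; lia).
  split; [exact Hsz |]. split; [| exact Hsx].
  destruct (Z.lt_ge_cases (s * y) 0) as [Hy | Hy]; [exact Hy | exfalso].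
  set (X := (s * x)%Z) in *; set (Y := (s * y)%Z) in *.
  set (W := (- (s * z))%Z).
  assert (HXYW : (X >= Y /\ Y >= W /\ W >= 1)%Z)
    by (unfold X, Y, W in *; destruct Hs as [-> | ->]; lia).
  assert (HW : (k < W ^ 2)%Z)
    by (unfold W; destruct Hs as [-> | ->]; nia).
  assert (E : (X ^ 3 + Y ^ 3 - W ^ 3 = s * k)%Z)
    by (unfold X, Y, W; destruct Hs as [-> | ->]; rewrite <- Hsum; ring).
  clearbody X Y W.
  clear - Hk Hs HXYW HW E.
  assert (H1 : (W ^ 3 <= Y ^ 3)%Z) by (apply Z.pow_le_mono_l; clear - HXYW; lia).
  assert (H2 : (W ^ 3 <= X ^ 3)%Z) by (apply Z.pow_le_mono_l; clear - HXYW; lia).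
  assert (H3 : (W ^ 2 <= W ^ 3)%Z) by (apply Z.pow_le_mono_r; clear - HXYW; lia).
  destruct Hs as [-> | ->]; lia.
Qed.

(** * The size of d *)

Lemma alpha_cube : ((1 + alpha) ^ 3 = 2)%R.
Proof.
  unfold alpha.
  replace (1 + (Rpower 2 (1 / 3) - 1))%R with (Rpower 2 (1 / 3)) by ring.
  rewrite <- Rpower_pow by apply exp_pos.
  rewrite Rpower_mult.
  replace (1 / 3 * INR 3)%R with 1%R by (simpl; field).
  apply Rpower_1; lra.
Qed.

Lemma alpha_lower : (1 / 4 < alpha)%R.
Proof.
  assert (H := alpha_cube).
  assert (0 < 1 + alpha)%R.
  { unfold alpha; assert (0 < Rpower 2 (1 / 3))%R by apply exp_pos; lra. }
  destruct (Rlt_le_dec (1 / 4) alpha) as [Hl | Hl]; [exact Hl | exfalso].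
  assert ((1 + alpha) ^ 3 <= (5 / 4) ^ 3)%R by (apply pow_incr; lra).
  lra.
Qed.

(** For [Y = Z] one has [(Y + alpha * Z)^3 = Y^3 + Z^3] exactly; if
    [Y >= Z + 1], the left side exceeds the right one by at least
    [6 * alpha * Z^2], which is more than [Z^2] because [alpha > 1/4]. *)
Lemma cube_gap (X Y Z : R) :
  (1 <= Z)%R -> (Z + 1 <= Y)%R ->
  (X ^ 3 < Y ^ 3 + Z ^ 3 + Z ^ 2)%R ->
  (X - Y < alpha * Z)%R.
Proof.
  intros HZ HY HX.
  assert (Ha := alpha_lower). assert (Ha3 := alpha_cube).
  destruct (Rlt_le_dec (X - Y) (alpha * Z)) as [Hl | Hl]; [exact Hl | exfalso].
  assert (HaZ : (0 < alpha * Z)%R) by (apply Rmult_lt_0_compat; lra).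
  assert (H3 : ((Y + alpha * Z) ^ 3 <= X ^ 3)%R) by (apply pow_incr; lra).
  set (t := (Y - Z)%R).
  assert (Ht : (1 <= t)%R) by (unfold t; lra).
  assert (E : ((Y + alpha * Z) ^ 3 - Y ^ 3 =
               ((1 + alpha) ^ 3 - 1) * Z ^ 3
               + alpha * Z * (6 * Z * t + 3 * t ^ 2 + 3 * (alpha * Z) * t))%R)
    by (unfold t; ring).
  rewrite Ha3 in E.
  assert (H6 : (6 * Z <= 6 * Z * t + 3 * t ^ 2 + 3 * (alpha * Z) * t)%R).
  { assert (Z <= Z * t)%R by nra.
    assert (0 <= alpha * Z * t)%R by (apply Rmult_le_pos; lra).
    assert (0 <= t ^ 2)%R by apply pow2_ge_0. lra. }
  assert (H7 : (alpha * Z * (6 * Z) <=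
          alpha * Z * (6 * Z * t + 3 * t ^ 2 + 3 * (alpha * Z) * t))%R)
    by (apply Rmult_le_compat_l; lra).
  assert (H8 : (Z ^ 2 <= alpha * Z * (6 * Z))%R) by nra.
  lra.
Qed.

Lemma abs_sum_lt_alpha (x y z k s : Z) :
  (0 < k)%Z -> (k < z ^ 2)%Z -> (s = 1 \/ s = -1)%Z ->
  (x ^ 3 + y ^ 3 + z ^ 3 = k)%Z ->
  (Z.abs x >= Z.abs y)%Z -> (Z.abs y >= Z.abs z)%Z -> (y <> z)%Z ->
  (0 < s * (x + y))%Z ->
  (IZR (s * (x + y)) < alpha * IZR (Z.abs z))%R.
Proof.
  intros Hk Hkz Hs Hsum Hxy Hyz Hne Hd.
  destruct (signs_of_solution x y z k s Hk Hkz Hs Hsum Hxy Hyz Hd)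
    as (Hsz & Hsy & Hsx).
  assert (Hz : Z.abs z = (- (s * z))%Z) by (destruct Hs as [-> | ->]; lia).
  replace (IZR (s * (x + y)))%R with (IZR (s * x) - IZR (- (s * y)))%R
    by (rewrite <- minus_IZR; f_equal; ring).
  rewrite Hz.
  apply cube_gap.
  - apply IZR_le; lia.
  - rewrite <- plus_IZR; apply IZR_le; destruct Hs as [-> | ->]; lia.
  - rewrite !pow_IZR, <- !plus_IZR; apply IZR_lt; simpl Z.of_nat.
    destruct Hs as [-> | ->]; lia.
Qed.

(** * Square conditions *)

Lemma sqr_divide (d m : Z) : (d <> 0)%Z -> (d ^ 2 | m ^ 2)%Z -> (d | m)%Z.
Proof.
  intros Hd H.
  assert (Hg0 := Z.gcd_nonneg d m).
  assert (Hg : (Z.gcd d m <> 0)%Z) by (intros E; apply Z.gcd_eq_0_l in E; lia).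
  destruct (Z.gcd_divide_l d m) as [a Ha].
  destruct (Z.gcd_divide_r d m) as [b Hb].
  remember (Z.gcd d m) as g eqn:Eg.
  assert (Hab : Z.gcd a b = 1%Z).
  { rewrite Ha, Hb, Z.gcd_mul_mono_r_nonneg in Eg by lia.
    apply Z.mul_cancel_r with g; lia. }
  assert (H2 : (a * a | b * b)%Z).
  { apply (Z.mul_divide_cancel_l (a * a) (b * b) (g ^ 2)); [nia |].
    replace (g ^ 2 * (a * a))%Z with (d ^ 2)%Z by (rewrite Ha; ring).
    replace (g ^ 2 * (b * b))%Z with (m ^ 2)%Z by (rewrite Hb; ring).
    exact H. }
  assert (Hrel : rel_prime a b) by (apply Zgcd_1_rel_prime; exact Hab).
  rewrite Ha, Hb; apply Z.mul_divide_mono_r.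
  apply Gauss with b; [| exact Hrel].
  apply Z.divide_trans with (a * a)%Z; [apply Z.divide_factor_l | exact H2].
Qed.

(** Multiples of [d] that pass the square test are [d] times a value of
    the norm form [(d^2 + 3 * r^2) / 4]. *)
Lemma norm_form_of_square (d q : Z) :
  (0 < d)%Z -> is_square (3 * d * (4 * (d * q) - d ^ 3)) ->
  exists r : Z, (0 <= r /\ 4 * q = d ^ 2 + 3 * r ^ 2)%Z.
Proof.
  intros Hd [m Hm].
  assert (Hdm : (d | m)%Z).
  { apply sqr_divide; [lia |].
    exists (3 * (4 * q - d ^ 2))%Z. rewrite <- Hm; ring. }
  destruct Hdm as [n ->].
  assert (Hn : (3 * (4 * q - d ^ 2) = n ^ 2)%Z).
  { apply Z.mul_cancel_l with (d ^ 2)%Z; [nia |].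
    transitivity ((n * d) ^ 2)%Z; [rewrite <- Hm |]; ring. }
  assert (H3 : (3 | n)%Z).
  { destruct (prime_mult 3 prime_3 n n) as [H | H]; [| exact H | exact H].
    exists (4 * q - d ^ 2)%Z. lia. }
  destruct H3 as [r ->].
  exists (Z.abs r). split; [apply Z.abs_nonneg |].
  rewrite <- Z.pow_even_abs by (exists 1%Z; reflexivity).
  clear - Hn. lia.
Qed.

Lemma same_parity (d r q : Z) :
  (4 * q = d ^ 2 + 3 * r ^ 2)%Z -> exists u : Z, (d + r = 2 * u)%Z.
Proof.
  intros H.
  assert (Hev : Z.Even (d + r)).
  { destruct (Z.Even_or_Odd (d + r)) as [He | [w Hw]]; [exact He |].
    exfalso.
    (* If [d + r] is odd, then [d^2 + 3 * r^2] is odd. *)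
    replace d with (2 * w + 1 - r)%Z in H by lia.
    ring_simplify in H. lia. }
  destruct Hev as [u Hu]; exists u; exact Hu.
Qed.

(** * The two roots *)

Lemma sgn_abs_of_signed (a s : Z) :
  (s = 1 \/ s = -1)%Z -> (0 < s * a)%Z -> Z.sgn a = s /\ Z.abs a = (s * a)%Z.
Proof.
  intros [-> | ->] H; split; lia.
Qed.

Lemma root_term_eq (k d z r : Z) :
  (0 < d)%Z -> (0 <= r)%Z ->
  (4 * Z.abs (k - z ^ 3) = d * (d ^ 2 + 3 * r ^ 2))%Z ->
  root_term k d z = IZR r.
Proof.
  intros Hd Hr H.
  unfold root_term.
  replace (4 * Z.abs (k - z ^ 3) - d ^ 3)%Z with (r * r * (3 * d))%Z
    by (rewrite H; ring).
  rewrite !mult_IZR with (m := (3 * d)%Z).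
  assert (0 < IZR (3 * d))%R by (apply IZR_lt; lia).
  unfold Rdiv; rewrite Rmult_assoc, Rinv_r, Rmult_1_r by lra.
  rewrite mult_IZR; apply sqrt_square, IZR_le, Hr.
Qed.

Lemma signed_half_eq (s t x : Z) :
  (s * t = 2 * x)%Z -> (1 / 2 * IZR s * IZR t = IZR x)%R.
Proof.
  intros H. apply (f_equal IZR) in H. rewrite !mult_IZR in H. lra.
Qed.

(** * Solutions of the cubic equation and the square condition *)

Lemma solution_to_S (k eps : Z) (B : R) (x y z : Z) :
  (0 < k)%Z -> (eps = 1 \/ eps = -1)%Z -> (k mod 9 = (3 * eps) mod 9)%Z ->
  (x ^ 3 + y ^ 3 + z ^ 3 = k)%Z ->
  (Z.abs x >= Z.abs y)%Z -> (Z.abs y >= Z.abs z)%Z ->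
  (IZR (Z.abs z) > sqrt (IZR k))%R -> y <> z -> (IZR (Z.abs z) <= B)%R ->
  let d := Z.abs (x + y) in
  (0 < IZR d < alpha * B)%R /\ Z.gcd d 3 = 1%Z /\ S_cond k eps B d z /\
  Same_set R (Couple R (IZR x) (IZR y))
             (Couple R (root_plus k d z) (root_minus k d z)).
Proof.
  intros Hk He Hke Hsum Hxy Hyz Hz Hne HzB.
  assert (Hkz : (k < z ^ 2)%Z).
  { apply lt_IZR. rewrite (Z.pow_even_abs z) by (exists 1%Z; reflexivity).
    rewrite <- (pow_IZR _ 2).
    rewrite <- (pow2_sqrt (IZR k)) by (apply IZR_le; lia).
    assert (0 <= sqrt (IZR k))%R by apply sqrt_pos. nra. }
  rewrite <- Hsum in Hke at 1.
  destruct (sum_cubes_mod9 x y z eps He Hke) as (Hx3 & Hy3 & _).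
  assert (Hnz : (x + y <> 0)%Z).
  { intros E. assert (E3 : ((x + y) mod 3 = 0)%Z) by (rewrite E; reflexivity).
    rewrite Z.add_mod, Hx3, Hy3 in E3 by lia.
    destruct He as [-> | ->]; discriminate E3. }
  assert (Hs : exists s : Z, (s = 1 \/ s = -1)%Z /\ (0 < s * (x + y))%Z).
  { destruct (Z.lt_ge_cases 0 (x + y)); [exists 1%Z | exists (-1)%Z]; lia. }
  destruct Hs as (s & Hs & Hd).
  intros d.
  assert (Ed : d = (s * (x + y))%Z) by exact (proj2 (sgn_abs_of_signed _ _ Hs Hd)).
  clearbody d.
  assert (Hd0 : (0 < d)%Z) by (rewrite Ed; exact Hd).
  assert (Hleg : (eps * legendre3 d = - s)%Z)
    by (rewrite Ed; apply legendre3_abs_sum; assumption).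
  destruct (signs_of_solution x y z k s Hk Hkz Hs Hsum Hxy Hyz Hd)
    as (Hsz & Hsy & Hsx).
  assert (Hlt : (IZR d < alpha * IZR (Z.abs z))%R)
    by (rewrite Ed; apply abs_sum_lt_alpha with k; assumption).
  assert (Ha := alpha_lower).
  assert (Hss : (s * s = 1)%Z) by (destruct Hs as [-> | ->]; reflexivity).
  assert (Ekz : (k - z ^ 3 = s * d * (x ^ 2 - x * y + y ^ 2))%Z).
  { replace (k - z ^ 3)%Z with (x ^ 3 + y ^ 3)%Z by (rewrite <- Hsum; ring).
    rewrite Ed, sum_cubes_factor, Z.mul_assoc, Hss; ring. }
  assert (Hq := norm_form_pos x y Hnz).
  assert (Hpos : (0 < s * (k - z ^ 3))%Z).
  { rewrite Ekz, !Z.mul_assoc, Hss.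
    rewrite Z.mul_1_l; apply Z.mul_pos_pos; assumption. }
  split; [| split; [| split]].
  - split; [apply IZR_lt, Hd0 |].
    apply Rlt_le_trans with (1 := Hlt).
    apply Rmult_le_compat_l; [lra | exact HzB].
  - apply gcd3_legendre3. clear - Hs He Hleg.
    destruct Hs as [-> | ->]; destruct He as [-> | ->]; lia.
  - split; [| split; [| split]].
    + split; [| exact HzB].
      change (Rpower 2 (1 / 3) - 1)%R with alpha.
      apply Rmult_lt_reg_r with alpha; [lra |].
      unfold Rdiv; rewrite Rmult_assoc, Rinv_l by lra. lra.
    + rewrite Hleg. clear - Hs Hsz.
      destruct Hs as [-> | ->]; lia.
    + replace k with (z ^ 3 + s * (x ^ 2 - x * y + y ^ 2) * d)%Z
        by (transitivity (z ^ 3 + (k - z ^ 3))%Z; [rewrite Ekz |]; ring).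
      rewrite Z_mod_plus_full; reflexivity.
    + exists (3 * d * (x - y))%Z.
      replace (4 * eps * legendre3 d * (z ^ 3 - k))%Z
        with (4 * s * (k - z ^ 3))%Z
        by (rewrite <- (Z.mul_assoc 4 eps), Hleg; ring).
      rewrite Ekz.
      replace (4 * s * (s * d * (x ^ 2 - x * y + y ^ 2)))%Z
        with (s * s * (4 * d * (x ^ 2 - x * y + y ^ 2)))%Z by ring.
      replace (d ^ 3)%Z with (d * (s * s * (x + y) ^ 2))%Z
        by (rewrite Ed; ring).
      rewrite Hss; ring.
  - destruct (sgn_abs_of_signed _ _ Hs Hpos) as [Hsg Hab].
    assert (Hr : root_term k d z = IZR (s * (x - y))).
    { apply root_term_eq;
        [exact Hd0 | clear - Hs Hsx Hsy; destruct Hs as [-> | ->]; lia |].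
      rewrite Hab, Ekz.
      replace (s * (s * d * (x ^ 2 - x * y + y ^ 2)))%Z
        with (s * s * d * (x ^ 2 - x * y + y ^ 2))%Z by ring.
      replace (d ^ 2 + 3 * (s * (x - y)) ^ 2)%Z
        with (s * s * ((x + y) ^ 2 + 3 * (x - y) ^ 2))%Z
        by (rewrite Ed; ring).
      rewrite Hss; ring. }
    unfold root_plus, root_minus.
    rewrite Hr, Hsg, <- plus_IZR, <- minus_IZR.
    rewrite (signed_half_eq s _ x)
      by (rewrite Ed; destruct Hs as [-> | ->]; ring).
    rewrite (signed_half_eq s _ y)
      by (rewrite Ed; destruct Hs as [-> | ->]; ring).
    split; intros u Hu; exact Hu.
Qed.

Lemma S_to_solution (k eps : Z) (B : R) (d z : Z) :
  (eps = 1 \/ eps = -1)%Z -> (0 < d)%Z -> Z.gcd d 3 = 1%Z ->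
  S_cond k eps B d z ->
  exists x y : Z,
    IZR x = root_plus k d z /\ IZR y = root_minus k d z /\
    (x ^ 3 + y ^ 3 + z ^ 3 = k)%Z.
Proof.
  intros He Hd Hg (_ & _ & Hmod & Hsq).
  apply gcd3_legendre3 in Hg.
  assert (Hs : exists s : Z, (s = 1 \/ s = -1)%Z /\ (eps * legendre3 d = - s)%Z).
  { exists (- (eps * legendre3 d))%Z.
    destruct He as [-> | ->]; destruct Hg as [-> | ->]; lia. }
  destruct Hs as (s & Hs & Hleg).
  assert (Hss : (s * s = 1)%Z) by (destruct Hs as [-> | ->]; reflexivity).
  assert (Hdiv : exists q : Z, (s * (k - z ^ 3) = d * q)%Z).
  { assert (H1 := Z_div_mod_eq_full (z ^ 3) d).
    assert (H2 := Z_div_mod_eq_full k d).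
    exists (s * (k / d - z ^ 3 / d))%Z. nia. }
  destruct Hdiv as [q Hq].
  replace (4 * eps * legendre3 d * (z ^ 3 - k))%Z with (4 * (d * q))%Z in Hsq
    by (rewrite <- Hq, <- (Z.mul_assoc 4 eps), Hleg; ring).
  destruct (norm_form_of_square d q Hd Hsq) as (r & Hr0 & Hr).
  assert (Hpos : (0 < s * (k - z ^ 3))%Z) by nia.
  destruct (sgn_abs_of_signed _ _ Hs Hpos) as [Hsg Hab].
  assert (Ert : root_term k d z = IZR r).
  { apply root_term_eq; [exact Hd | exact Hr0 |].
    rewrite Hab, Hq, <- Hr; ring. }
  destruct (same_parity d r q Hr) as [u Hu].
  exists (s * u)%Z, (s * (d - u))%Z.
  unfold root_plus, root_minus.
  rewrite Ert, Hsg, <- plus_IZR, <- minus_IZR.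
  split; [| split].
  - symmetry; apply signed_half_eq. rewrite Hu; ring.
  - symmetry; apply signed_half_eq. replace r with (2 * u - d)%Z by lia. ring.
  - assert (Eq : (q = d ^ 2 - 3 * d * u + 3 * u ^ 2)%Z).
    { replace r with (2 * u - d)%Z in Hr by lia. lia. }
    assert (Ek : (k - z ^ 3 = s * (d * q))%Z)
      by (rewrite <- Hq, Z.mul_assoc, Hss; ring).
    replace ((s * u) ^ 3 + (s * (d - u)) ^ 3)%Z
      with (s * s * (s * (d * (d ^ 2 - 3 * d * u + 3 * u ^ 2))))%Z by ring.
    rewrite Hss, <- Eq. lia.
Qed.

Theorem mainTheorem2 (k eps : Z) (B : R)
  (hk0 : (0 < k)%Z)
  (hk : (k mod 9 = 3 mod 9 \/ k mod 9 = (-3) mod 9)%Z)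
  (heps : (eps = 1 \/ eps = -1)%Z)
  (hkeps : (k mod 9 = (3 * eps) mod 9)%Z)
  (hB : (0 < B)%R) :
  (forall x y z : Z,
     (x ^ 3 + y ^ 3 + z ^ 3 = k)%Z ->
     (Z.abs x >= Z.abs y)%Z ->
     (Z.abs y >= Z.abs z)%Z ->
     (IZR (Z.abs z) > sqrt (IZR k))%R ->
     y <> z ->
     (IZR (Z.abs z) <= B)%R ->
     let d := Z.abs (x + y) in
     (0 < IZR d < alpha * B)%R /\
     Z.gcd d 3 = 1%Z /\
     S_cond k eps B d z /\
     Same_set R (Couple R (IZR x) (IZR y))
                (Couple R (root_plus k d z) (root_minus k d z)))
  /\
  (forall d z : Z,
     (0 < IZR d < alpha * B)%R ->
     Z.gcd d 3 = 1%Z ->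
     S_cond k eps B d z ->
     exists x y : Z,
       IZR x = root_plus k d z /\
       IZR y = root_minus k d z /\
       (x ^ 3 + y ^ 3 + z ^ 3 = k)%Z).

Proof.
  split.
  - intros x y z; apply solution_to_S; assumption.
  - intros d z [Hd _]; apply S_to_solution; [exact heps | exact (lt_IZR _ _ Hd)].
Qed.
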